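(* Let $k\ge 2$. Every regular $k$-ary Arnoux-Rauzy sequence is the faithful coding of the $B$-integers for some Cantor real base $B$. In particular, every standard Sturmian sequence is the faithful coding of the $B$-integers for some Cantor real base $B$.
   Context: For $i\in\{0,\ldots,k-1\}$ let $L_i\colon\{0,\ldots,k-1\}^*\to\{0,\ldots,k-1\}^*$ be the morphism with $L_i(i)=i$ and $L_i(j)=ij$ for $j\ne i$. Every standard Arnoux-Rauzy sequence over $\{0,\ldots,k-1\}$ can be written as $\lim_{n\to\infty}\psi_0\psi_1\cdots\psi_{n-1}(0)$ with $\psi_n\in\{L_0,\ldots,L_{k-1}\}$ (limit in the product topology). A standard Arnoux-Rauzy sequence is regular if its $S$-adic expansion can be expressed in the form $\psi_0\psi_1\psi_2\cdots=L_{i_1}^{a_1}L_{i_2}^{a_2}L_{i_3}^{a_3}\cdots$ for positive integers $a_1,a_2,a_3,\ldots$ where the sequence $(i_n)_{n\ge 1}$ is purely periodic with period $k$ and contains every letter of $\{0,\ldots,k-1\}$. A standard Sturmian sequence is a standard Arnoux-Rauzy sequence over a binary alphabet ($k=2$). A Cantor real base is a bi-infinite sequence $B=(\beta_n)_{n\in\mathbb{Z}}$ of real numbers $\beta_n>1$ with $\prod_{n=1}^{+\infty}\beta_n=\prod_{n=1}^{+\infty}\beta_{-n}=+\infty$. For a bi-infinite sequence $\mathbf{a}=(a_n)_{n\in\mathbb{Z}}$ of non-negative integers with $a_n=0$ for all sufficiently large $n$, put $\mathrm{val}_B(\mathbf{a})=\sum_{n=0}^{+\infty}a_n\beta_{n-1}\cdots\beta_0+\sum_{n=1}^{+\infty}\frac{a_{-n}}{\beta_{-1}\cdots\beta_{-n}}$;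 if this is finite, $\mathbf{a}$ is a $B$-representation of $\mathrm{val}_B(\mathbf{a})$. The $B$-expansion of a non-negative real $x$ is its largest $B$-representation in the radix order, where $\mathbf{a}<_{\mathrm{rad}}\mathbf{b}$ if there is $i\in\mathbb{Z}$ with $a_j=b_j$ for all $j>i$ and $a_i<b_i$. (Equivalently it is produced by the greedy algorithm.) A non-negative real number $x$ is a $B$-integer if its $B$-expansion $(a_n)_{n\in\mathbb{Z}}$ satisfies $a_n=0$ for all $n<0$. The $B$-integers form a discrete set, listed increasingly as $0=x_0<x_1<x_2<\cdots$. An infinite word $w_0w_1w_2\cdots$ is the faithful coding of the $B$-integers if it encodes the distances between consecutive $B$-integers with precisely one letter per distance, i.e. for all $m,n\ge 0$, $w_m=w_n$ if and only if $x_{m+1}-x_m=x_{n+1}-x_n$ (it is unique up to renaming letters). *)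

(* Defs.v *)
(* Infinite words over {0, ..., k-1} are functions
   nat -> 'I_k, finite words are sequences over 'I_k, and bi-infinite
   sequences are functions on int. *)
From HB Require Import structures.
From mathcomp Require Import all_boot all_order all_algebra.
From mathcomp Require Import all_classical all_reals all_analysis.

Set Implicit Arguments.
Unset Strict Implicit.
Unset Printing Implicit Defensive.

Import Order.TTheory GRing.Theory Num.Theory.
Import numFieldNormedType.Exports.

Local Open Scope classical_set_scope.
Local Open Scope ring_scope.

Section Words.
Variable k : nat.
Implicit Types (w : nat -> 'I_k) (u : seq 'I_k) (psi : nat -> 'I_k).

Definition factor_at w (i n : nat) : seq 'I_k :=
  mkseq (fun j => w (i + j)%N) n.

Definition is_factor w u := exists i, u = factor_at w i (size u).

Definition recurrent w := forall u, is_factor w u ->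
  forall N, exists2 i, (N <= i)%N & u = factor_at w i (size u).

Definition left_special w u := exists c d : 'I_k,
  [/\ c != d, is_factor w (c :: u) & is_factor w (d :: u)].

Definition right_special w u := exists c d : 'I_k,
  [/\ c != d, is_factor w (rcons u c) & is_factor w (rcons u d)].

Definition arnoux_rauzy w :=
  recurrent w /\
  forall n : nat,
    (exists u, [/\ size u = n, left_special w u,
       (forall v, size v = n -> left_special w v -> v = u)
     & (forall c : 'I_k, is_factor w (c :: u))]) /\
    (exists u, [/\ size u = n, right_special w u,
       (forall v, size v = n -> right_special w v -> v = u)
     & (forall c : 'I_k, is_factor w (rcons u c))]).

Definition standard_arnoux_rauzy w :=
  arnoux_rauzy w /\ forall n : nat, left_special w (factor_at w 0 n).

(* The morphism fixing i and mapping every other letter j to the word ij. *)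
Definition L (i : 'I_k) (u : seq 'I_k) : seq 'I_k :=
  flatten [seq (if j == i then [:: i] else [:: i; j]) | j <- u].

(* A directive sequence (L_{psi 0}, L_{psi 1}, ...) is encoded by the
   sequence psi of indices; this is L_{psi 0} ( ... (L_{psi (n-1)} u)). *)
Definition L_iter psi (n : nat) u : seq 'I_k := foldr L u (mkseq psi n).

(* w is the limit, in the product topology, of the finite words obtained
   by applying L_{psi 0} ... L_{psi (n-1)} to the letter 0: every position
   is eventually defined and constant. *)
Definition S_adic_expansion psi w :=
  exists2 z : 'I_k, z = 0%N :> nat &
    forall m : nat, \forall n \near \oo,
      onth (L_iter psi n [:: z]) m = Some (w m).

(* psi lists the indices of L_{i 0}^{a 0} L_{i 1}^{a 1} ...; the runs are
   numbered from 0. *)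
Definition regular_directive psi :=
  exists (i : nat -> 'I_k) (a : nat -> nat),
    [/\ forall n, (0 < a n)%N,
        forall n, i (n + k)%N = i n,
        forall c : 'I_k, exists n, i n = c
      & forall n r, (r < a n)%N -> psi (\sum_(l < n) a l + r)%N = i n].

Definition regular_arnoux_rauzy w :=
  standard_arnoux_rauzy w /\
  exists psi, S_adic_expansion psi w /\ regular_directive psi.

End Words.

Definition standard_sturmian (w : nat -> 'I_2) := standard_arnoux_rauzy w.

Section CantorBases.
Variable R : realType.
Implicit Types (B : int -> R) (a b : int -> nat) (x : R).

Definition cantor_real_base B :=
  [/\ forall n, 1 < B n,
      (fun n : nat => \prod_(1 <= j < n.+1) B j%:Z) @ \oo --> +oo
    & (fun n : nat => \prod_(1 <= j < n.+1) B (- j%:Z)) @ \oo --> +oo].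

Definition finitely_many_high_digits a :=
  exists N : int, forall n : int, N <= n -> a n = 0%N.

(* The empty product gives the digit a_0 weight 1; both series have
   nonnegative terms, so the value always exists in [0, +oo]. *)
Definition valB B a : \bar R :=
  (\sum_(0 <= n <oo) ((a n%:Z)%:R * \prod_(0 <= j < n) B j%:Z)%:E
   + \sum_(1 <= n <oo)
       ((a (- n%:Z))%:R / \prod_(1 <= j < n.+1) B (- j%:Z))%:E)%E.

Definition B_representation B a x :=
  finitely_many_high_digits a /\ valB B a = x%:E.

Definition rad_lt a b :=
  exists i : int, (forall j : int, i < j -> a j = b j) /\ (a i < b i)%N.

Definition B_expansion B a x :=
  B_representation B a x /\
  forall b, B_representation B b x -> b =1 a \/ rad_lt b a.

Definition B_integer B x :=
  0 <= x /\
  exists a, B_expansion B a x /\ forall n : int, n < 0 -> a n = 0%N.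

Definition faithful_coding_of_B_integers (A : Type) B (w : nat -> A) :=
  exists x : nat -> R,
    [/\ x 0%N = 0,
        forall m n : nat, (m < n)%N -> x m < x n,
        forall y, B_integer B y <-> exists n, y = x n
      & forall m n : nat, w m = w n <-> x m.+1 - x m = x n.+1 - x n].

End CantorBases.

(* Main.v *)
(* Only the weights U_n = beta_0 ... beta_(n-1) matter for B-integers: they are
   the greedy sums of the U_n, so the B-integers below U_(n+1) are the translates
   q U_n + y of the B-integers y < U_n, cut at U_(n+1).
   For a regular directive sequence L_(i_0)^(a_0) L_(i_1)^(a_1) ..., let
   phi_n be the product of the first n powers.  The prefixes s_n = phi_n(i_n) of
   w satisfy s_(n+1) = s_n^(a_n) phi_n(i_(n+1)), where phi_n(i_(n+1)) is a prefix
   of s_n, except for its last letter while some letters are still unused.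
   Giving the letters the lengths ell(i_j) = 1/(j+1) for j < k, that last gap is
   a gap of s_n cut short, so the weights U_n = ell(s_n) produce exactly the
   points whose successive distances are the lengths of the letters of w.
   A standard Sturmian word is regular because desubstituting L_(w_0) preserves
   the property that the left special factors are exactly the prefixes. *)
Require Import Defs.
From mathcomp Require Import all_boot all_order all_algebra.
From mathcomp Require Import all_classical all_reals all_analysis.
From mathcomp Require Import ring zify.

Set Implicit Arguments.
Unset Strict Implicit.
Unset Printing Implicit Defensive.

Import Order.TTheory GRing.Theory Num.Theory.
Import numFieldNormedType.Exports.

Local Open Scope classical_set_scope.
Local Open Scope ring_scope.

(** * B-integers as greedy sums *)

Section BaseOfWeights.
Variables (R : realType) (U : nat -> R).
Hypothesis U0 : U 0%N = 1.
Hypothesis U_increasing : {homo U : m n / (m < n)%N >-> m < n}.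
Hypothesis U_unbounded : U @ \oo --> +oo.

(** Every base at a negative index is 2, so the fractional places are dyadic and can hold any
    non-negative remainder. *)
Definition base_of_weights (n : int) : R :=
  if n is Posz m then U m.+1 / U m else 2.

(** The bounds are the greedy condition: the digits below place [M] never add up to [U M], so no
    carry is possible. *)
Definition greedy_sum (N : nat) (y : R) := exists d : nat -> nat,
  y = \sum_(j < N) (d j)%:R * U j /\
  forall M, (M <= N)%N -> \sum_(j < M) (d j)%:R * U j < U M.

Lemma U_gt0 n : 0 < U n.
Proof.
case: n => [|n]; first by rewrite U0.
by apply: lt_trans (U_increasing (ltn0Sn n)); rewrite U0.
Qed.

Lemma prod_pos_base m n : (m < n)%N ->
  \prod_(m <= j < n) base_of_weights j%:Z = U n / U m.
Proof.
by move=> mn; apply: telescope_prodf => // k _; rewrite gt_eqF ?U_gt0.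
Qed.

Lemma prod_pos_base0 n : \prod_(0 <= j < n) base_of_weights j%:Z = U n.
Proof.
case: n => [|n]; first by rewrite big_geq ?U0.
by rewrite prod_pos_base // U0 divr1.
Qed.

Lemma prod_neg_base n :
  \prod_(1 <= j < n.+1) base_of_weights (- j%:Z) = 2 ^+ n.
Proof.
rewrite big_add1 /= (eq_bigr (fun _ => 2)) ?prodr_const_nat ?subn0 //.
Qed.

Lemma cantor_real_base_of_weights : cantor_real_base base_of_weights.
Proof.
split=> [[n|n]||] /=.
- by rewrite ltr_pdivlMr ?U_gt0 // mul1r U_increasing.
- by rewrite ltr1n.
- have -> : (fun n => \prod_(1 <= j < n.+1) base_of_weights j%:Z) =
            (fun n => if n is 0 then 1 else U n.+1 / U 1%N).
    by apply/funext => -[|n]; [rewrite big_geq | rewrite prod_pos_base].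
  apply/cvgryPge => A; have /cvgryPge/(_ (A * U 1%N)) := U_unbounded.
  case=> N _ UN; exists N.+1 => // -[//|n] /= Nn.
  by rewrite ler_pdivlMr ?U_gt0 //; apply: UN => /=; lia.
- under eq_fun do rewrite prod_neg_base.
  have gt2 : (1 : R) < 2 by rewrite ltr1n.
  apply/cvgryPge => A; near=> n.
  apply: (@le_trans _ _ n%:R); last first.
    by rewrite -natrX ler_nat ltnW // ltn_expl.
  by near: n; exact: nbhs_infty_ger.
Unshelve. all: by end_near.
Qed.

Lemma valB_base_of_weights (a : int -> nat) :
  valB base_of_weights a =
  (\sum_(0 <= n <oo) ((a n%:Z)%:R * U n)%:E +
   \sum_(1 <= n <oo) ((a (- n%:Z))%:R / 2 ^+ n)%:E)%E.
Proof.
congr (_ + _)%E.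
  by apply: eq_eseriesr => n _; rewrite prod_pos_base0.
by apply: eq_eseriesr => n _; rewrite prod_neg_base.
Qed.

Lemma nneseries_finite (f : nat -> R) N : (forall n, (N <= n)%N -> f n = 0) ->
  (\sum_(0 <= n <oo) (f n)%:E = (\sum_(j < N) f j)%:E)%E.
Proof.
move=> f0; apply: lim_near_cst => //; exists N => // n /= Nn.
rewrite sumEFin (big_cat_nat (leq0n N) Nn) //= [X in _ + X]big1_seq.
  by rewrite addr0 big_mkord.
by move=> j /andP[_]; rewrite mem_index_iota => /andP[/f0].
Qed.

(* Needed to show that non-greedy digits are not maximal: the remainder after
   a carry is moved to negative positions. *)
Lemma dyadic_representation (r : R) : 0 <= r -> exists e : nat -> nat,
  (\sum_(1 <= n <oo) ((e n)%:R / 2 ^+ n)%:E)%E = r%:E.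
Proof.
move=> r0.
(* No digit has index 0, so [t 0] is 0 and the first digit [t 1] also absorbs the integer part of
   [r]. The partial sums telescope to [t n / 2 ^+ n]. *)
pose t n := if n is 0 then 0%N else Num.truncn (2 ^+ n * r).
have pr n : 0 <= 2 ^+ n * r by rewrite mulr_ge0 ?exprn_ge0.
have tS n : t n.+1 = Num.truncn (2 ^+ n.+1 * r) by [].
have t2 n : (2 * t n <= t n.+1)%N.
  case: n => [|n]; first by [].
  rewrite !tS truncn_ge_nat // natrM (exprS _ n.+1) -mulrA ler_pM2l //.
  by rewrite truncn_le.
exists (fun n => t n - 2 * t n.-1)%N.
have psum n : \sum_(1 <= j < n.+1) (t j - 2 * t j.-1)%:R / 2 ^+ j =
              (t n)%:R / 2 ^+ n :> R.
  elim: n => [|n IH]; first by rewrite big_geq // mul0r.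
  rewrite big_nat_recr //= IH natrB // natrM exprS.
  by field; rewrite expf_neq0.
apply: cvg_lim => //; rewrite -(cvg_shiftS _ (nbhs r%:E)).
under eq_fun do rewrite sumEFin psum.
apply: cvg_EFin; first by near=> n.
apply/cvgrPdist_le => eps eps0 /=.
near=> n; have n0 : (0 < n)%N by near: n; exists 1%N.
have p2 : 0 < 2 ^+ n :> R by rewrite exprn_gt0.
have -> : t n = Num.truncn (2 ^+ n * r) by rewrite -(prednK n0).
have /truncn_itv/andP[lo hi] := pr n.
have -> : r - (Num.truncn (2 ^+ n * r))%:R / 2 ^+ n =
          (2 ^+ n * r - (Num.truncn (2 ^+ n * r))%:R) / 2 ^+ n.
  by field; rewrite gt_eqF.
rewrite normrM normfV (gtr0_norm p2) ger0_norm ?subr_ge0 // ler_pdivrMr //.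
apply: (@le_trans _ _ 1); first by rewrite lerBlDl natr1 ltW.
rewrite -ler_pdivrMl // mulr1.
apply: (@le_trans _ _ n%:R); first by near: n; exact: nbhs_infty_ger.
by rewrite -natrX ler_nat ltnW // ltn_expl.
Unshelve. all: by end_near.
Qed.

Lemma greedy_sum_extend N y : greedy_sum N y -> exists d : nat -> nat,
  [/\ forall j, (N <= j)%N -> d j = 0%N,
      y = \sum_(j < N) (d j)%:R * U j
    & forall M, \sum_(j < M) (d j)%:R * U j < U M].
Proof.
move=> [d [yE dlt]].
pose d' j := if (j < N)%N then d j else 0%N.
have d'E M : (M <= N)%N ->
    \sum_(j < M) (d' j)%:R * U j = \sum_(j < M) (d j)%:R * U j.
  by move=> MN; apply: eq_bigr => j _; rewrite /d' (leq_trans (ltn_ord j)).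
exists d'; split; first by move=> j Nj; rewrite /d' ltnNge Nj.
  by rewrite d'E.
move=> M; have [MN|NM] := leqP M N; first by rewrite d'E // dlt.
rewrite -(subnKC (ltnW NM)) big_split_ord /= [X in _ + X]big1 ?addr0.
  rewrite d'E // (lt_trans (dlt N _)) // U_increasing //.
  by rewrite subnKC // ltnW.
by move=> j _; rewrite /d' ltnNge leq_addr mul0r.
Qed.

Lemma nonneg_digits_high (a : int -> nat) : finitely_many_high_digits a ->
  exists N : nat, forall n, (N <= n)%N -> a n%:Z = 0%N.
Proof.
move=> [M aM]; exists `|M|%N => n Mn; apply: aM.
by apply: le_trans (ler_norm M) _; rewrite -abszE lez_nat.
Qed.

Lemma sum_cut (f : nat -> R) M K : \sum_(j < M.+1 + K) f j =
  \sum_(j < M) f j + f M + \sum_(j < K) f (M.+1 + j)%N.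
Proof. by rewrite big_split_ord big_ord_recr. Qed.

(** If the digits below [M] summed to at least [U M], carrying into place [M] and writing the excess
    in the dyadic places would give a larger representation of [y]. *)
Lemma B_integer_greedy y :
  B_integer base_of_weights y -> exists N, greedy_sum N y.
Proof.
move=> [y0 [a [[[/nonneg_digits_high[N aN] vala] maxa] aneg]]].
have yE : y = \sum_(j < N) (a j%:Z)%:R * U j.
  apply: EFin_inj; rewrite -vala valB_base_of_weights.
  rewrite (@nneseries_finite (fun n => (a n%:Z)%:R * U n) N); last first.
    by move=> n /aN ->; rewrite mul0r.
  rewrite eseries0 ?adde0 // => -[//|n] _ _.
  by rewrite -NegzE aneg // mul0r.
exists N, (fun j => a j%:Z); split=> // M _; rewrite ltNge; apply/negP => leUM.
have [e eE] : exists e : nat -> nat, (\sum_(1 <= n <oo)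
    ((e n)%:R / 2 ^+ n)%:E = (\sum_(j < M) (a j%:Z)%:R * U j - U M)%:E)%E.
  by apply: dyadic_representation; rewrite subr_ge0.
pose b (n : int) := match n with
  | Posz m => if (m < M)%N then 0%N else if m == M then (a M).+1 else a m
  | Negz m => e m.+1
  end.
have bM : b M = (a M).+1 by rewrite /b ltnn eqxx.
have bhi (m : nat) : (M < m)%N -> b m = a m.
  by move=> Mm; rewrite /b ltnNge ltnW // gtn_eqF.
have bN (m : nat) : (M.+1 + N <= m)%N -> b m = 0%N.
  by move=> le_m; rewrite bhi ?aN //; lia.
have brep : B_representation base_of_weights b y.
  split.
    by exists (M.+1 + N)%:Z => -[m|m] // le_m; apply: bN; rewrite -lez_nat.
  rewrite valB_base_of_weights.
  rewrite (@nneseries_finite (fun n => (b n%:Z)%:R * U n) (M.+1 + N)).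
    2: by move=> n /bN ->; rewrite mul0r.
  have -> : (\sum_(1 <= n <oo) ((b (- n%:Z)%R)%:R / 2 ^+ n : R)%:E =
             \sum_(1 <= n <oo) ((e n)%:R / 2 ^+ n)%:E)%E.
    congr (limn _); apply/funext => n; apply: eq_big_nat => -[//|j] _.
    by rewrite -NegzE.
  rewrite eE -EFinD; congr _%:E.
  have -> : y = \sum_(j < M.+1 + N) (a j%:Z)%:R * U j.
    rewrite addnC big_split_ord /= [X in _ + X]big1 ?addr0 //.
    by move=> j _; rewrite aN ?leq_addr // mul0r.
  rewrite !(sum_cut (fun j => (_ j%:Z)%:R * U j)).
  rewrite [X in X + _ + _ + _]big1; last first.
    by move=> j _; rewrite /b ltn_ord mul0r.
  rewrite bM [X in _ + X + _ = _](eq_bigr (fun j : 'I_N =>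
    (a (M.+1 + j)%N)%:R * U (M.+1 + j)%N)).
    2: by move=> j _; rewrite bhi // leq_addr.
  by rewrite -natr1; ring.
(* [b] exceeds [a] at [M] and agrees with it above, so it can be neither equal to [a] nor below
   it. *)
case: (maxa b brep) => [/(_ M)|[i [heq hlt]]]; first by rewrite bM; lia.
have [iM|Mi] := ltP i M%:Z; first by have := heq _ iM; rewrite bM; lia.
case: i Mi heq hlt => // i; rewrite lez_nat leq_eqVlt => /orP[/eqP <-|Mi] _.
  by rewrite bM; lia.
by rewrite bhi // ltnn.
Qed.

(** A representation whose highest difference is an excess at a place [m >= 0] is too large, by the
    bound on the digits below [m]. If the excess is at a negative place, the non-negative places
    already sum to [y]. *)
Lemma greedy_B_integer N y :
  greedy_sum N y -> B_integer base_of_weights y.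
Proof.
move=> /greedy_sum_extend[d [dN yE dlt]].
have y0 : 0 <= y.
  by rewrite yE sumr_ge0 // => j _; rewrite mulr_ge0 // ltW // U_gt0.
pose a (n : int) := if n is Posz m then d m else 0%N.
have series_d : (\sum_(0 <= n <oo) ((d n)%:R * U n)%:E = y%:E)%E.
  rewrite yE (@nneseries_finite (fun n => _) N) // => n /dN ->.
  by rewrite mul0r.
split=> //; exists a; split; last by case.
split.
  split; first by exists N => -[m|m] //= /dN.
  rewrite valB_base_of_weights series_d eseries0 ?adde0 //.
  by move=> -[//|n] _ _; rewrite -NegzE mul0r.
move=> b [/nonneg_digits_high[Nb bN] valb].
have [ba|nba] := pselect (b =1 a); [by left|right].
pose K := maxn N Nb.
have hiK (j : int) : K%:Z <= j -> b j = a j.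
  case: j => // j; rewrite lez_nat geq_max => /andP[/dN dj /bN bj].
  by rewrite bj /= dj.
have [i [ineq ihi]] :
    exists i : int, b i <> a i /\ forall j, i < j -> b j = a j.
  (* Both sequences vanish from [K] on, so the highest difference is the one nearest to [K]. *)
  pose P n := b (K%:Z - n%:Z) != a (K%:Z - n%:Z).
  have /ex_minnP[n Pn minn] : exists n, P n.
    have [j bj] : exists j, b j != a j.
      apply: contrapT => nex; apply: nba => j; apply/eqP; apply: contrapT.
      by move=> /negP bj; apply: nex; exists j.
    exists `|K%:Z - j|%N; rewrite /P gez0_abs; last first.
      rewrite subr_ge0 leNgt; apply/negP => /ltW/hiK/eqP.
      by rewrite (negbTE bj).
    by rewrite subKr.
  exists (K%:Z - n%:Z); split; first exact/eqP.
  move=> j nj; have [/hiK//|jK] := leP K%:Z j; apply: contrapT => /eqP bj.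
  have := minn `|K%:Z - j|%N; rewrite /P gez0_abs; last by lia.
  by rewrite subKr => /(_ bj); lia.
exists i; split => //; rewrite ltnNge leq_eqVlt.
apply/negP => /orP[/eqP/esym//|lt_i].
have term_ge0 n : 0 <= (b n%:Z)%:R * U n by rewrite mulr_ge0 // ltW // U_gt0.
move: valb; rewrite valB_base_of_weights.
case: i ineq ihi lt_i => [m _|m _] ihi /= lt_m.
- have mK : (m < K)%N.
    rewrite -ltz_nat ltNge; apply/negP => /hiK bm.
    by move: lt_m; rewrite bm /= ltnn.
  have /= := @nneseries_lim_ge R (fun n => ((b n%:Z)%:R * U n)%:E) xpredT 0 K
    (fun n _ _ => term_ge0 n).
  have sum2 : (0 <= \sum_(1 <= n <oo) ((b (- n%:Z)%R)%:R / 2 ^+ n : R)%:E)%E.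
    by apply: nneseries_ge0 => n _ _; rewrite lee_fin divr_ge0 // exprn_ge0.
  move=> /leeD/(_ sum2) sum_le valb; move: sum_le; rewrite valb.
  rewrite adde0 sumEFin lee_fin big_mkord.
  have -> : y = \sum_(j < K) (d j)%:R * U j.
    rewrite /K -(subnKC (leq_maxl N Nb)) big_split_ord /= -yE big1 ?addr0 //.
    by move=> j _; rewrite dN ?leq_addr // mul0r.
  rewrite -(subnKC mK) (sum_cut (fun j => (b j%:Z)%:R * U j)).
  rewrite (sum_cut (fun j => (d j)%:R * U j)).
  rewrite [X in _ + X <= _](eq_bigr (fun j : 'I_(K - m.+1) =>
    (d (m.+1 + j)%N)%:R * U (m.+1 + j)%N)); last first.
    by move=> j _; rewrite ihi //= ltz_nat leq_addr.
  (* The common digits above [m] cancel; [b m] is at least [d m + 1], while the digits of [d] below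
     [m] sum to less than [U m]. *)
  rewrite lerD2r leNgt => /negP; apply.
  apply: (@lt_le_trans _ _ (U m + (d m)%:R * U m)); first by rewrite ltrD2r dlt.
  apply: (@le_trans _ _ ((b m)%:R * U m)).
    by rewrite -[X in X + _]mul1r -mulrDl nat1r ler_pM2r ?U_gt0 // ler_nat.
  by rewrite lerDr sumr_ge0.
- have -> : (\sum_(0 <= n <oo) ((b n%:Z)%:R * U n)%:E = y%:E)%E.
    by rewrite -series_d; apply: eq_eseriesr => n _; rewrite ihi.
  have pos n : (0 <= ((b (- n%:Z))%:R / 2 ^+ n)%:E :> \bar R)%E.
    by rewrite lee_fin divr_ge0 // exprn_ge0.
  have /= := @nneseries_lim_ge R (fun n => ((b (- n%:Z))%:R / 2 ^+ n)%:E) xpredT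
    1 m.+2 (fun n _ _ => pos n).
  rewrite big_nat_recr //= => le2 eqy.
  have : (0 < \sum_(1 <= n <oo) ((b (- n%:Z)%R)%:R / 2 ^+ n : R)%:E)%E.
    apply: lt_le_trans le2; apply: (@lt_le_trans _ _
      ((b (- (m.+1)%:Z))%:R / 2 ^+ m.+1)%:E); last by rewrite leeDr // sume_ge0.
    by rewrite lte_fin -NegzE divr_gt0 ?exprn_gt0 // ltr0n.
  move=> sum_gt0; have : (y%:E < y%:E)%E by rewrite -{2}eqy lteDl.
  by rewrite ltxx.
Qed.

End BaseOfWeights.

(** * Discrete sets built from translated copies of their initial segments *)

Section QuasiPeriodicSets.
Variables (R : realType) (x : nat -> R) (len : nat -> nat).
Hypothesis x0 : x 0%N = 0.
Hypothesis x_increasing : {homo x : m n / (m < n)%N >-> m < n}.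
Hypothesis len0 : len 0%N = 1%N.
(** The segment of index [N.+1] consists of [a] copies of that of index [N] and the first [e.+1]
    points of one more; the last inequality allows its final gap to be shorter. *)
Hypothesis lenS : forall N, exists a e, [/\ (0 < a)%N, (e < len N)%N,
  len N.+1 = (a * len N + e).+1,
  forall q m, (m <= len N)%N -> (q * len N + m <= a * len N + e)%N ->
    x (q * len N + m)%N = q%:R * x (len N) + x m
  & x (len N.+1) <= a%:R * x (len N) + x e.+1].

Let x_lt m n : (x m < x n) = (m < n)%N.
Proof. exact: (leW_mono (le_mono x_increasing)). Qed.

Let x_le m n : (x m <= x n) = (m <= n)%N.
Proof. exact: (le_mono x_increasing). Qed.

Lemma len_lt N : (len N < len N.+1)%N.
Proof.
have [a [e [a0 _ -> _ _]]] := lenS N.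
by rewrite ltnS (leq_trans (leq_pmull _ a0)) ?leq_addr.
Qed.

Lemma len_gt N : (N < len N)%N.
Proof. by elim: N => [|N IH]; [rewrite len0 | have := len_lt N; lia]. Qed.

(** Euclidean division of the index by [len N] gives the top digit as quotient; the remainder is
    treated by induction. *)
Lemma greedy_sum_range N y :
  greedy_sum (fun n => x (len n)) N y <-> exists2 m, (m < len N)%N & y = x m.
Proof.
elim: N y => [|N IH] y.
  split=> [[d [-> _]]|[m]]; first by exists 0%N; rewrite ?len0 // big_ord0 x0.
  rewrite len0 ltnS leqn0 => /eqP -> ->; exists (fun=> 0%N).
  split=> [|M]; first by rewrite big_ord0 x0.
  by rewrite leqn0 => /eqP ->; rewrite big_ord0 -x0 x_lt len0.
have [a [e [a0 e_lt lenE xper xS]]] := lenS N.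
split.
- move=> [d [yE dlt]].
  have [|m m_lt mE] := (IH (\sum_(j < N) (d j)%:R * x (len j))).1.
    by exists d; split=> // M MN; apply: dlt; rewrite ltnW.
  have := dlt _ (leqnn N.+1); rewrite -yE => y_lt.
  move: yE; rewrite big_ord_recr /= mE addrC => yE.
  have xm0 : 0 <= x m by rewrite -x0 x_le.
  have xlen0 : 0 < x (len N) by rewrite -x0 x_lt (leq_ltn_trans _ (len_gt N)).
  (* The bound by [x (len N.+1)] rules out a top digit above [a], and forces [m <= e] when the top
     digit is [a]. *)
  have idx : (d N * len N + m <= a * len N + e)%N.
    have: (d N)%:R * x (len N) + x m < a%:R * x (len N) + x e.+1.
      by rewrite -yE (lt_le_trans y_lt).
    have [lt_dN|gt_dN|->] := ltngtP (d N) a; first by nia.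
      rewrite ltNge => /negP[]; apply: (@le_trans _ _ (a.+1%:R * x (len N))).
        by rewrite -natr1 mulrDl mul1r lerD2l x_le.
      by rewrite -[X in X <= _]addr0 lerD // ler_pM2r // ler_nat.
    by rewrite ltrD2l x_lt ltnS leq_add2l.
  by exists (d N * len N + m)%N; rewrite ?lenE ?ltnS // xper // ltnW.
- move=> [m m_lt ->].
  have len_gt0 : (0 < len N)%N by exact: leq_ltn_trans (len_gt N).
  have m_mod : (m %% len N < len N)%N by rewrite ltn_mod.
  have [|d [dE dlt]] := (IH (x (m %% len N)%N)).2; first by exists (m %% len N)%N.
  have xm : x m = (m %/ len N)%:R * x (len N) + x (m %% len N)%N.
    rewrite {1}(divn_eq m (len N)) xper ?(ltnW m_mod) //.
    by rewrite -(divn_eq m) -ltnS -lenE.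
  exists (fun j => if j == N then (m %/ len N)%N else d j).
  have sumE M : (M <= N)%N -> \sum_(j < M)
      (if (j : nat) == N then (m %/ len N)%N else d j)%:R * x (len j) =
      \sum_(j < M) (d j)%:R * x (len j).
    move=> MN; apply: eq_bigr => j _.
    by rewrite (ltn_eqF (leq_trans (ltn_ord j) MN)).
  have sumN : \sum_(j < N.+1)
      (if (j : nat) == N then (m %/ len N)%N else d j)%:R * x (len j) = x m.
    by rewrite big_ord_recr /= sumE // eqxx -dE xm addrC.
  split=> // M; rewrite leq_eqVlt => /orP[/eqP ->|]; first by rewrite sumN x_lt.
  by rewrite ltnS => MN; rewrite sumE // dlt.
Qed.

Lemma B_integers_range : x 1%N = 1 -> x @ \oo --> +oo ->
  exists B : int -> R, cantor_real_base B /\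
    forall y, B_integer B y <-> exists n, y = x n.
Proof.
move=> x1 x_unbounded; pose U n := x (len n).
have U0 : U 0%N = 1 by rewrite /U len0.
have U_incr : {homo U : m n / (m < n)%N >-> m < n}.
  apply: homo_ltn; first exact: lt_trans.
  by move=> n; apply: x_increasing; exact: len_lt.
exists (base_of_weights U); split.
  apply: cantor_real_base_of_weights => //.
  apply/cvgryPge => A; have /cvgryPge/(_ A) [N _ xN] := x_unbounded.
  by exists N => // n /= Nn; apply: xN => /=; have := len_gt n; lia.
move=> y; split=> [/(B_integer_greedy U0 U_incr)[N /greedy_sum_range[m _ ->]]|].
  by exists m.
move=> [m ->]; apply: (@greedy_B_integer _ U _ _ m.+1) => //.
by apply/greedy_sum_range; exists m => //; apply: ltn_trans (len_gt _).
Qed.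

End QuasiPeriodicSets.

(** * Words with weighted letters *)

Section PrefixSums.
Variables (R : realType) (A : eqType) (ell : A -> R) (w : nat -> A).
Implicit Types u v : seq A.

Definition weight u := \sum_(c <- u) ell c.

Definition prefix_weight n := \sum_(j < n) ell (w j).

Lemma weight_cat u v : weight (u ++ v) = weight u + weight v.
Proof. exact: big_cat. Qed.

Lemma weight_rcons u c : weight (rcons u c) = weight u + ell c.
Proof. by rewrite -cats1 weight_cat /weight big_seq1. Qed.

Lemma weight_power n u : weight (flatten (nseq n u)) = n%:R * weight u.
Proof.
elim: n => [|n IH] /=; first by rewrite /weight big_nil mul0r.
by rewrite weight_cat IH -natr1 mulrDl mul1r addrC.
Qed.

Lemma weight_take n u : u = mkseq w (size u) -> (n <= size u)%N ->
  weight (take n u) = prefix_weight n.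
Proof.
move=> -> le_n; rewrite /mkseq -map_take take_iota (minn_idPl _).
  by rewrite /weight big_map -/(index_iota 0 n) -(subn0 n) big_mkord subn0.
by move: le_n; rewrite size_mkseq.
Qed.

End PrefixSums.

(* u is a prefix of v whose last letter may have been made lighter: in terms of
   lengths, the last gap of u may be a gap of v cut short. *)
Definition dominated (R : realType) (A : eqType) (ell : A -> R) (u v : seq A) :=
  exists t c c', [/\ u = rcons t c, prefix (rcons t c') v & ell c <= ell c'].

Lemma size_power (A : Type) n (u : seq A) :
  size (flatten (nseq n u)) = (n * size u)%N.
Proof. by rewrite size_flatten /shape map_nseq sumn_nseq mulnC. Qed.

(** The points are the weights of the prefixes of [w], and the sizes of the [s n] give the scales.
    The bound [eps] makes the points unbounded, and injectivity of [ell] makes the coding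
    faithful. *)
Lemma dominated_coding (R : realType) (A : eqType) (w : nat -> A)
    (ell : A -> R) (eps : R) (s : nat -> seq A) (a : nat -> nat) :
  injective ell -> 0 < eps -> (forall c, eps <= ell c) ->
  s 0%N = [:: w 0%N] -> ell (w 0%N) = 1 ->
  (forall n, s n = mkseq w (size (s n))) -> (forall n, (0 < a n)%N) ->
  (forall n, exists2 u, s n.+1 = flatten (nseq (a n) (s n)) ++ u &
                        dominated ell u (s n)) ->
  exists B : int -> R, cantor_real_base B /\ faithful_coding_of_B_integers B w.
Proof.
move=> ell_inj eps0 ell_ge s0 ell1 sw a_gt0 sS.
pose x := prefix_weight ell w.
have xS n : x n.+1 = x n + ell (w n) by rewrite /x /prefix_weight big_ord_recr.
have x0 : x 0%N = 0 by rewrite /x /prefix_weight big_ord0.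
have x_incr : {homo x : m n / (m < n)%N >-> m < n}.
  apply: homo_ltn; first exact: lt_trans.
  by move=> n; rewrite xS ltrDl (lt_le_trans eps0).
have x_unbounded : x @ \oo --> +oo.
  have x_ge n : n%:R * eps <= x n.
    elim: n => [|n IH]; first by rewrite x0 mul0r.
    by rewrite -natr1 mulrDl mul1r xS lerD.
  apply/cvgryPge => M; near=> n; apply: le_trans (x_ge n).
  by rewrite -ler_pdivrMr //; near: n; exact: nbhs_infty_ger.
have [|||||B [Bcantor Brange]] := @B_integers_range R x (fun n => size (s n)) x0.
- exact: x_incr.
- by rewrite s0.
- move=> n; have [u sE [t [c [c' [uE /prefixP[v sv] le_c]]]]] := sS n.
  have lenE : size (s n.+1) = (a n * size (s n) + size t).+1.
    by rewrite sE size_cat size_power uE size_rcons addnS.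
  have t_lt : (size t < size (s n))%N by rewrite sv size_cat size_rcons leq_addr.
  exists (a n), (size t); split=> //.
    move=> q m m_le idx_le.
    have qa : (q <= a n)%N.
      rewrite leqNgt; apply/negP => aq.
      by have := leq_mul aq (leqnn (size (s n))); lia.
    rewrite /x -(weight_take ell (sw n.+1)); last by rewrite lenE ltnW // ltnS.
    (* Without its last letter, [s n.+1] is a prefix of [(a n).+1] copies of [s n]. *)
    have -> : take (q * size (s n) + m) (s n.+1) =
              flatten (nseq q (s n)) ++ take m (s n).
      have powE : flatten (nseq (a n).+1 (s n)) =
                  (flatten (nseq (a n) (s n)) ++ t) ++ c' :: v.
        rewrite -(addn1 (a n)) nseqD flatten_cat /= cats0 [X in _ ++ X = _]sv.
        by rewrite cat_rcons catA.
      transitivity (take (q * size (s n) + m) (flatten (nseq (a n).+1 (s n)))).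
        have idx_size : (q * size (s n) + m <=
            size (flatten (nseq (a n) (s n)) ++ t))%N.
          by rewrite size_cat size_power.
        by rewrite powE sE uE -cats1 catA !(takel_cat _ idx_size).
      rewrite -(subnKC (leqW qa)) nseqD flatten_cat subSn // take_cat size_power.
      by rewrite ltnNge leq_addr /= addKn takel_cat.
    by rewrite weight_cat weight_power -!(weight_take ell (sw n)) // take_size.
  (* Only the last letter differs from the copy: [c] stands where the copy has the possibly heavier
     [c']. *)
  rewrite /x -(weight_take ell (sw n.+1)) // -!(weight_take ell (sw n)) //.
  rewrite !take_size sE weight_cat weight_power lerD2l uE sv.
  by rewrite -(size_rcons t c') take_size_cat // !weight_rcons lerD2l.
- by rewrite xS x0 add0r.
- exact: x_unbounded.
exists B; split=> //; exists x; split=> // m n.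
rewrite !xS !(addrC (x _)) !addrK; split=> [->//|]; exact: ell_inj.
Unshelve. all: by end_near.
Qed.

(** * Iterated morphisms *)

Section Morphisms.
Variable k : nat.
Implicit Types (c d : 'I_k) (u v : seq 'I_k) (psi : nat -> 'I_k).

Lemma L_cat c u v : L c (u ++ v) = L c u ++ L c v.
Proof. by rewrite /L map_cat flatten_cat. Qed.

Lemma L_cons c d u :
  L c (d :: u) = if d == c then c :: L c u else c :: d :: L c u.
Proof. by rewrite /L /=; case: (d == c). Qed.

Lemma L_iterS psi n u : L_iter psi n.+1 u = L_iter psi n (L (psi n) u).
Proof. by rewrite /L_iter mkseqS foldr_rcons. Qed.

Lemma L_iter_cat psi n u v :
  L_iter psi n (u ++ v) = L_iter psi n u ++ L_iter psi n v.
Proof. by elim: n u v => [|n IH] u v //; rewrite !L_iterS L_cat IH. Qed.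

Lemma size_L c u : (size u <= size (L c u))%N.
Proof.
elim: u => [|d u IH] //.
by rewrite L_cons; case: eqP => /= _; rewrite ltnS ?leqW.
Qed.

Lemma size_L_iter psi n u : (size u <= size (L_iter psi n u))%N.
Proof.
elim: n u => [|n IH] u //.
by rewrite L_iterS (leq_trans (size_L (psi n) u)).
Qed.

(** The [r]-th power of [L c] fixes [c] and puts [r] copies of [c] in front of any other letter. *)
Lemma L_iter_run psi N r c d : (forall q, (q < r)%N -> psi (N + q)%N = c) ->
  L_iter psi (N + r) [:: d] =
  flatten (nseq (if d == c then 0 else r) (L_iter psi N [:: c]))
    ++ L_iter psi N [:: d].
Proof.
move=> run; elim: r d run => [|r IH] d run; first by rewrite addn0 if_same.
have {}IH := IH _ (fun q qr => run q (ltnW qr)).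
rewrite addnS L_iterS run // L_cons.
have [->|dc] := eqVneq d c; first by rewrite IH eqxx.
by rewrite -[[:: c; d]]/([:: c] ++ [:: d]) L_iter_cat !IH eqxx (negbTE dc) catA.
Qed.

End Morphisms.

Section Dominated.
Variables (R : realType) (A : eqType) (ell : A -> R).
Implicit Types u v p : seq A.

Lemma dominated_prefix u v : u != [::] -> prefix u v -> dominated ell u v.
Proof.
by case/lastP: u => // t c _ uv; exists t, c, c.
Qed.

Lemma dominated_cat p u v : dominated ell u v -> dominated ell (p ++ u) (p ++ v).
Proof.
move=> [t [c [c' [-> tv le_c]]]]; exists (p ++ t), c, c'.
by rewrite !rcons_cat prefix_catr // eqxx.
Qed.

End Dominated.

Section PeriodicLetters.
Variables (k : nat) (i : nat -> 'I_k).
Hypothesis i_periodic : forall n, i (n + k)%N = i n.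
Hypothesis i_onto : forall c, exists n, i n = c.

Lemma periodic_mod n : i n = i (n %% k)%N.
Proof.
rewrite {1}(divn_eq n k); elim: (n %/ k)%N => [|q IH] //.
by rewrite mulSn -addnA addnC i_periodic.
Qed.

Lemma mem_period c : c \in mkseq i k.
Proof.
have k_gt0 : (0 < k)%N by exact: leq_ltn_trans (ltn_ord c).
have [n <-] := i_onto c; rewrite periodic_mod.
by apply: map_f; rewrite mem_iota /= add0n ltn_mod.
Qed.

(** A period has [k] entries and contains all [k] letters, so none is repeated. *)
Lemma period_uniq : uniq (mkseq i k).
Proof.
apply: (@leq_size_uniq _ (enum 'I_k)); first exact: enum_uniq.
  by move=> c _; exact: mem_period.
by rewrite size_mkseq size_enum_ord.
Qed.

Lemma period_neq n p : (0 < p < k)%N -> (i (n + p)%N == i n) = false.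
Proof.
move=> /andP[p_gt0 p_lt]; have k_gt0 := ltn_trans p_gt0 p_lt.
rewrite (periodic_mod (n + p)) (periodic_mod n); apply/negP => /eqP.
move=> /(mkseq_uniqP i k period_uniq); rewrite !inE !ltn_mod => /(_ k_gt0 k_gt0).
move/eqP; rewrite -{2}(addn0 n) eqn_modDl mod0n modn_small //.
by rewrite gtn_eqF.
Qed.

End PeriodicLetters.

(** * Images of letters under a regular directive sequence *)

Section RegularDirective.
Variables (R : realType) (k : nat) (psi i : nat -> 'I_k) (a : nat -> nat).
Hypothesis a_gt0 : forall n, (0 < a n)%N.
Hypothesis i_periodic : forall n, i (n + k)%N = i n.
Hypothesis i_onto : forall c, exists n, i n = c.
Hypothesis psi_run :
  forall n r, (r < a n)%N -> psi (\sum_(l < n) a l + r)%N = i n.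

Let i_neq := period_neq i_periodic i_onto.
Let start n := (\sum_(l < n) a l)%N.
Let word n c := L_iter psi (start n) [:: c].

Lemma wordS n c : word n.+1 c =
  flatten (nseq (if c == i n then 0 else a n)%N (word n (i n))) ++ word n c.
Proof.
by rewrite /word /start big_ord_recr /= (L_iter_run _ (@psi_run n)).
Qed.

Lemma word_neq0 n c : word n c != [::].
Proof.
have := size_L_iter psi (start n) [:: c].
by rewrite -/(word n c); case: (word n c).
Qed.

(* At stage n the letters are ordered by their next use as a directive letter:
   the later that use is, the more recent the previous one was, and the
   shorter the image. *)
Lemma word_dominated (ell : 'I_k -> R) :
  (forall p q, (p < q < k)%N -> ell (i q) <= ell (i p)) ->
  forall n p q, (p < q < k)%N ->
    dominated ell (word n (i (n + q)%N)) (word n (i (n + p)%N)).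
Proof.
move=> ell_decr; elim=> [|n IH] p q pqk.
  have word0 c : word 0 c = [:: c] by rewrite /word /start big_ord0.
  (* At stage 0 the words are single letters, and only their weights are compared. *)
  by rewrite !word0; exists [::], (i q), (i p); rewrite prefix_refl ell_decr.
have /andP[pq qk] := pqk; rewrite !addSnnS !wordS.
(* If [q.+1 = k], the shorter image is that of [i n]: the power just applied fixes this letter, and
   its image now begins the image of every other letter. *)
have [qk1|qk1] := eqVneq q.+1 k.
  rewrite qk1 i_periodic eqxx i_neq; last by lia.
  rewrite /= -(prednK (a_gt0 n)) /= -catA.
  by apply: dominated_prefix; [exact: word_neq0 | exact: prefix_prefix].
(* Otherwise both images gain the same prefix, and induction applies to [p.+1] and [q.+1]. *)
rewrite !i_neq; [|by lia..].
by apply: dominated_cat; apply: IH; lia.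
Qed.

(** Asking for prefixes of [w] instead of a limit covers both S-adic expansions and iterated
    desubstitution. *)
Lemma directive_coding (w : nat -> 'I_k) : (2 <= k)%N ->
  (forall N, L_iter psi N [:: psi N] =
             mkseq w (size (L_iter psi N [:: psi N]))) ->
  exists B : int -> R, cantor_real_base B /\ faithful_coding_of_B_integers B w.
Proof.
move=> k2 w_prefix; have k_gt0 : (0 < k)%N by exact: ltnW.
have in_period := mem_period i_periodic i_onto.
(* Letters are ranked by their place in the first period, so the weights decrease along it from 1 to
   [1/k]. *)
pose ell (c : 'I_k) : R := (index c (mkseq i k)).+1%:R^-1.
have ell_i p : (p < k)%N -> ell (i p) = p.+1%:R^-1.
  move=> pk; rewrite /ell -{1}(nth_mkseq (i 0%N) i pk) index_uniq //.
    by rewrite size_mkseq.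
  exact: period_uniq.
have psi_start n : psi (start n) = i n by rewrite -[start n]addn0 psi_run.
have w0 : w 0%N = i 0%N.
  have := w_prefix 0%N.
  by rewrite /L_iter /= -(psi_start 0%N) /start big_ord0 => -[].
apply: (@dominated_coding _ _ w ell k%:R^-1 (fun n => word n (i n)) a).
- move=> c d /invr_inj/eqP; rewrite eqr_nat eqSS => /eqP cd.
  by rewrite -(nth_index c (in_period c)) cd nth_index.
- by rewrite invr_gt0 ltr0n.
- move=> c; rewrite lef_pV2 ?posrE ?ltr0n // ler_nat.
  by have := in_period c; rewrite -index_mem size_mkseq.
- by rewrite /word /start big_ord0 w0.
- by rewrite w0 ell_i ?invr1.
- by move=> n; rewrite /word -psi_start; exact: w_prefix.
- exact: a_gt0.
move=> n; exists (word n (i n.+1)).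
  by rewrite wordS -addn1 i_neq.
have ell_decr p q : (p < q < k)%N -> ell (i q) <= ell (i p).
  move=> /andP[pq qk]; have pk := ltn_trans pq qk.
  by rewrite !ell_i // lef_pV2 ?posrE ?ltr0n // ler_nat ltnW.
by have := word_dominated ell_decr n (k2 : (0 < 1 < k)%N); rewrite addn0 addn1.
Qed.

End RegularDirective.

(** * Prefixes of S-adic limits *)

Lemma head_L k (c : 'I_k) u : u != [::] -> prefix [:: c] (L c u).
Proof.
case: u => // d u _.
by rewrite L_cons; case: ifP; rewrite prefix_cons eqxx prefix0s.
Qed.

Lemma prefix_L_iter k (psi : nat -> 'I_k) n u v :
  prefix u v -> prefix (L_iter psi n u) (L_iter psi n v).
Proof. by move=> /prefixP[t ->]; rewrite L_iter_cat prefix_prefix. Qed.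

(** [L c] of a nonempty word starts with [c], so whatever the inner morphisms produce, the word fed
    to the outer [n] ones starts with [psi n]. *)
Lemma L_iter_prefix k (psi : nat -> 'I_k) n m u : u != [::] -> (n < m)%N ->
  prefix (L_iter psi n [:: psi n]) (L_iter psi m u).
Proof.
move=> u0 /subnKC <-; elim: (m - n.+1)%N u u0 => [|r IH] u u0.
  by rewrite addn0 L_iterS; apply: prefix_L_iter; apply: head_L.
rewrite addnS L_iterS; apply: IH.
by rewrite -size_eq0 -lt0n (leq_trans _ (size_L _ _)) // lt0n size_eq0.
Qed.

Lemma S_adic_prefix k (psi w : nat -> 'I_k) : S_adic_expansion psi w ->
  forall N, L_iter psi N [:: psi N] =
            mkseq w (size (L_iter psi N [:: psi N])).
Proof.
move=> [z _ psi_lim] N; set u := L_iter psi N _.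
apply: (@eq_from_nth _ z); first by rewrite size_mkseq.
move=> j j_lt; rewrite nth_mkseq //.
have [M _ psiM] := psi_lim j.
have := psiM (maxn M N.+1) (leq_maxl _ _).
have /prefixP[v ->] : prefix u (L_iter psi (maxn M N.+1) [:: z]).
  by apply: L_iter_prefix => //; rewrite leq_maxr.
by rewrite onth_cat j_lt => /(onth_nth z).
Qed.

(** * Sturmian words *)

Lemma ord2_other (c d e : 'I_2) : c != e -> d != e -> c = d.
Proof.
move=> ce de; apply: val_inj; move: ce de; rewrite -!val_eqE /=.
by move: (ltn_ord c) (ltn_ord d) (ltn_ord e); lia.
Qed.

(** The lengths of the maximal constant runs are the exponents; over two letters consecutive runs
    alternate, which is period 2. *)
Lemma alternating_regular (psi : nat -> 'I_2) :
  (forall N, exists M, (N < M)%N && (psi M != psi N)) -> regular_directive psi.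
Proof.
move=> change; pose next N := ex_minn (change N).
have nextP N : [/\ (N < next N)%N, psi (next N) != psi N &
    forall M, (N <= M < next N)%N -> psi M = psi N].
  rewrite /next; case: ex_minnP => M /andP[NM psiM] minM; split=> // M'.
  rewrite leq_eqVlt => /andP[/orP[/eqP <-//|NM'] M'M].
  apply/eqP; apply: contraLR M'M => psiM'.
  by rewrite -leqNgt minM // NM'.
pose start n := iter n next 0%N.
have startS n : (start n < start n.+1)%N by have [] := nextP (start n).
have alt n : psi (start n.+1) != psi (start n) by have [] := nextP (start n).
exists (fun n => psi (start n)), (fun n => start n.+1 - start n)%N; split.
- by move=> n; rewrite subn_gt0.
- by move=> n; rewrite addn2; apply: (ord2_other (alt n.+1)); rewrite eq_sym.
- move=> c; have [->|c0] := eqVneq c (psi (start 0%N)); first by exists 0%N.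
  by exists 1%N; apply: (ord2_other (alt 0%N)).
- move=> n r r_lt.
  have -> : (\sum_(l < n) (start l.+1 - start l) = start n)%N.
    elim: n {r_lt} => [|n IH]; first by rewrite big_ord0.
    by rewrite big_ord_recr /= IH subnKC // ltnW.
  have [_ _ -> //] := nextP (start n).
  by rewrite leq_addr -ltn_subRL.
Qed.

Section Occurrences.
Variable k : nat.
Implicit Types (w : nat -> 'I_k) (u v : seq 'I_k).

Definition occurs w j u := u = factor_at w j (size u).

Lemma occurs_cons w j c u : occurs w j (c :: u) <-> w j = c /\ occurs w j.+1 u.
Proof.
have fS n : factor_at w j n.+1 = w j :: factor_at w j.+1 n.
  rewrite /factor_at /mkseq /= addn0 (iotaDl 1 0) -map_comp.
  by congr (_ :: _); apply: eq_map => l; rewrite /= addnA addn1.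
rewrite /occurs /= fS; split=> [[-> {1}->]//|[-> {1}->]//].
Qed.

Lemma occurs_catl w j u v : occurs w j (u ++ v) -> occurs w j u.
Proof.
elim: u j => [|c u IH] j //=.
by move=> /occurs_cons[wj /IH occ]; apply/occurs_cons.
Qed.

End Occurrences.

(* For binary words this is all that is needed of standard Arnoux-Rauzy
   sequences, and it is inherited by the derived word. *)
Definition prefix_special (w : nat -> 'I_2) :=
  (forall n, left_special w (factor_at w 0 n)) /\
  (forall v, left_special w v -> occurs w 0 v).

(** Each length has a single left special factor, and the prefix of that length is one. *)
Lemma sturmian_prefix_special w : standard_sturmian w -> prefix_special w.
Proof.
move=> [[_ ar] std]; split=> // v v_special.
have [[u [_ _ u_uniq _]] _] := ar (size v).
rewrite /occurs (u_uniq v) // -(u_uniq (factor_at w 0 (size v))) //.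
  by rewrite size_mkseq.
by rewrite size_mkseq.
Qed.

(** * Desubstitution of a binary word *)

Section Derivation.
Variable w : nat -> 'I_2.
Let c := w 0%N.

(* Starting positions of the blocks [c] and [c; d] into which w factors. *)
Fixpoint block n : nat :=
  if n is m.+1 then
    (block m + (if w (block m).+1 == w 0%N then 1 else 2))%N
  else 0%N.

(** The letter after the opening [c] names the block: it is [d] in [[c; d]], and after [[c]] it is
    the [c] that opens the next block. *)
Definition derived n := w (block n).+1.

Hypothesis w_special : prefix_special w.

Lemma occurs1 j e : w j = e -> occurs w j [:: e].
Proof. by move=> wj; apply/occurs_cons. Qed.

(** Suppose [dd] occurs with [d] other than [c]. A [c] before some [d] would make [[d]] left special
    without being a prefix, so every [d] is preceded by [d], down to position 0. *)
Lemma isolated j : w j != c -> w j.+1 != c -> False.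
Proof.
move=> wj wj1; pose d := w j.
have back m : w m.+1 = d -> w m = d.
  move=> wm1; apply: contrapT => /eqP wm.
  suff /w_special.2 /occurs_cons[w0 _] : left_special w [:: d].
    by move: wj; rewrite /c w0 /d eqxx.
  exists (w m), d; split=> //.
    by exists m; apply/occurs_cons; split=> //; apply: occurs1.
  exists j; apply/occurs_cons; split=> //; apply: occurs1.
  exact: ord2_other wj1 wj.
have all_d m : w m = d -> w 0%N = d by elim: m => // m IH /back/IH.
by move: wj; rewrite /c (all_d j erefl) eqxx.
Qed.

Lemma w_block n : w (block n) = c.
Proof.
elim: n => //= n IH; case: ifPn => [/eqP|wn]; first by rewrite addn1.
by apply/eqP; rewrite addn2; apply: contrapT => /negP; exact: isolated.
Qed.

Lemma blockP j : w j = c -> exists n, j = block n.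
Proof.
suff: exists n, j = block n \/ (j = (block n).+1 /\ w j != c).
  by move=> [n [->|[_ /eqP wj] /wj//]]; exists n.
elim: j => [|j [n [->|[-> wj]]]]; first by exists 0%N; left.
  have [wn|wn] := eqVneq (w (block n).+1) c; last by exists n; right.
  by exists n.+1; left; rewrite /= wn eqxx addn1.
by exists n.+1; left; rewrite /= (negbTE wj) addn2.
Qed.

(** The trailing [c] opens the next block; without it, a final [c] might be only the first half of a
    block [[c; d]]. *)
Lemma occurs_derived u n :
  occurs w (block n) (L c u ++ [:: c]) <-> occurs derived n u.
Proof.
elim: u n => [|e u IH] n.
  by split=> // _; apply: occurs1; exact: w_block.
rewrite L_cons occurs_cons -(IH n.+1).
have [->|ec] := eqVneq e c; rewrite /= occurs_cons /derived.
- split=> [[_ occ]|[wn occ]].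
    have wn : w (block n).+1 = c.
      case: u occ {IH} => [|e' u] /=; first by move=> /occurs_cons[].
      by rewrite L_cons; case: ifP => _ /= /occurs_cons[].
    by rewrite wn eqxx addn1.
  by move: occ; rewrite wn eqxx addn1 w_block.
- rewrite occurs_cons; split=> [[_ [wn occ]]|[wn occ]].
    by rewrite wn (negbTE ec) addn2.
  by move: occ; rewrite wn (negbTE ec) addn2 w_block.
Qed.

(** On the left the letter [e] can stand for its whole block, since a letter other than [c] is
    always preceded by [c]. *)
Lemma factor_derived e v :
  is_factor derived (e :: v) <-> is_factor w (e :: L c v ++ [:: c]).
Proof.
have LE : L c (e :: v) ++ [:: c] =
    if e == c then e :: L c v ++ [:: c] else c :: e :: L c v ++ [:: c].
  by rewrite L_cons; case: eqP => [->|].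
split=> [[n /occurs_derived]|[j occ]].
  rewrite LE; case: ifP => _; first by exists (block n).
  by move=> /occurs_cons[_]; exists (block n).+1.
have /occurs_cons[wj _] := occ.
have [ec|ec] := eqVneq e c.
  have [|n jE] := @blockP j; first by rewrite wj.
  by exists n; apply/occurs_derived; move: occ; rewrite LE ec eqxx -jE.
case: j occ wj => [|j] occ wj; first by move: ec; rewrite -wj eqxx.
have wj0 : w j = c.
  apply/eqP; apply: contrapT => /negP wjc; apply: (isolated wjc).
  by rewrite wj.
have [n jE] := blockP wj0.
exists n; apply/occurs_derived; rewrite LE (negbTE ec) -jE.
by apply/occurs_cons.
Qed.

Lemma left_special_derived v :
  left_special derived v <-> left_special w (L c v ++ [:: c]).
Proof.
by split=> -[d [e [de /factor_derived dv /factor_derived ev]]]; exists d, e.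
Qed.

(** At position 0, [occurs_derived] matches the prefixes [v] of the derived word with the prefixes
    [L c v ++ [:: c]] of [w]. *)
Lemma derived_prefix_special : prefix_special derived.
Proof.
split=> [n|v /left_special_derived/w_special.2].
  apply/left_special_derived.
  have : occurs derived 0 (factor_at derived 0 n) by rewrite /occurs size_mkseq.
  by move=> /(occurs_derived _ 0) ->; exact: w_special.1.
exact: (occurs_derived _ 0).1.
Qed.

End Derivation.

Lemma iter_derived_special w n : prefix_special w ->
  prefix_special (iter n derived w).
Proof. by move=> w_special; elim: n => //= n; exact: derived_prefix_special. Qed.

(** If the first letters were all [c] from [N] on, each pull-back through [L c] would lengthen the
    initial run of [c]. The [N]-th derived word would be constant, and its empty factor would not be
    left special. *)
Lemma directive_changes w : prefix_special w -> forall N, exists M,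
  (N < M)%N && (iter M derived w 0%N != iter N derived w 0%N).
Proof.
move=> w_special N; apply: contrapT => const; pose c := iter N derived w 0%N.
have {}const m : iter (N + m) derived w 0%N = c.
  apply: contrapT => /eqP psim; apply: const.
  exists (N + m)%N; rewrite psim andbT.
  by case: m psim => [|m]; [rewrite addn0 eqxx | rewrite addnS ltnS leq_addr].
have pow r m : occurs (iter (N + m) derived w) 0 (nseq r.+1 c).
  elim: r m => [|r IH] m; first by apply/occurs_cons; rewrite const.
  have := IH m.+1; rewrite addnS /=.
  move=> /(occurs_derived (iter_derived_special (N + m) w_special) _ 0).
  have Lpow n : L c (nseq n c) = nseq n c.
    by elim: n => //= n IHn; rewrite L_cons eqxx IHn.
  rewrite const -[c :: _]/(nseq r.+1 c) Lpow.
  by rewrite -[[:: c]]/(nseq 1 c) -nseqD addn1.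
have w_c j : iter N derived w j = c.
  have := pow j 0%N; rewrite addn0 /occurs size_nseq => /(congr1 (nth c ^~ j)).
  by rewrite nth_nseq ltnSn nth_mkseq.
have [d [e [de [j dj] [l el]]]] := (iter_derived_special N w_special).1 0%N.
by move: de; have /occurs_cons[<- _] := dj; have /occurs_cons[<- _] := el;
  rewrite !w_c eqxx.
Qed.

Lemma occurs_L_iter w N u : prefix_special w ->
  occurs (iter N derived w) 0 u ->
  occurs w 0 (L_iter (fun n => iter n derived w 0%N) N u).
Proof.
move=> w_special; elim: N u => [|N IH] u //= occ.
rewrite L_iterS; apply: IH.
(* The letter added here is the marker that [occurs_derived] requires after the image. *)
apply: (@occurs_catl _ _ _ _ [:: iter N derived w 0%N]).
exact/(occurs_derived (iter_derived_special N w_special) _ 0).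
Qed.

Theorem corollary27 (R : realType) :
  (forall (k : nat) (w : nat -> 'I_k), (2 <= k)%N ->
     regular_arnoux_rauzy w ->
     exists B : int -> R,
       cantor_real_base B /\ faithful_coding_of_B_integers B w) /\
  (forall w : nat -> 'I_2, standard_sturmian w ->
     exists B : int -> R,
       cantor_real_base B /\ faithful_coding_of_B_integers B w).
Proof.
split=> [k w k2 [_ [psi [/S_adic_prefix w_prefix]]]|w /sturmian_prefix_special ws].
  by move=> [i [a [a_gt0 i_per i_onto run]]]; exact: directive_coding w_prefix.
have [i [a [a_gt0 i_per i_onto run]]] := alternating_regular (directive_changes ws).
apply: (directive_coding R a_gt0 i_per i_onto run) => // N.
(* The [N]-th directive letter is the first letter of the [N]-th derived word, hence a prefix of
   it. *)
by apply: occurs_L_iter => //; apply/occurs_cons.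
Qed.
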